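(* Let $X$ be a Polish space, $Y\subseteq\mathbb{R}$, and let $A\subseteq\mathcal{B}_1(X,Y)$ be a Polish space (for the topology of pointwise convergence). Then $\sup\{L(f) : f\in A\}<\omega_1$.
   Context: $\mathcal{B}_1(X,Y)$ is the set of Baire class one functions from $X$ to $Y$ (preimages of open sets are $F_\sigma$), equipped with the topology of pointwise convergence. For disjoint $G_\delta$ subsets $\mathcal{A},\mathcal{B}$ of $X$, let $R(\mathcal{A},\mathcal{B})$ be the set of increasing sequences $(G_\alpha)_{\alpha\leq\beta}$ of open subsets of $X$, with $\beta<\omega_1$, such that: (1) for each $\alpha<\beta$, $G_{\alpha+1}\setminus G_\alpha$ is disjoint from $\mathcal{A}$ or from $\mathcal{B}$; (2) $G_\gamma=\bigcup_{\alpha<\gamma}G_\alpha$ if $0<\gamma\leq\beta$ is a limit ordinal; (3) $G_0=\emptyset$ and $G_\beta=X$. This set is nonempty; put $L(\mathcal{A},\mathcal{B}):=\min\{\beta<\omega_1 : \exists (G_\alpha)_{\alpha\leq\beta}\in R(\mathcal{A},\mathcal{B})\}$. For $f\in\mathcal{B}_1(X,\mathbb{R})$ and reals $a<b$, $L(f,a,b):=L(\{f\leq a\},\{f\geq b\})$, and $L(f):=\sup\{L(f,q_1,q_2) : q_1<q_2\in\mathbb{Q}\}$. *)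

(* Defs.v *)
From HB Require Import structures.
From mathcomp Require Import all_boot all_order all_algebra.
From mathcomp Require Import all_classical all_reals all_analysis.
From mathcomp Require Import borel_hierarchy.
From mathcomp Require wochoice.
Set Implicit Arguments.
Unset Strict Implicit.
Unset Printing Implicit Defensive.
Import Order.TTheory GRing.Theory Num.Theory.
Import numFieldNormedType.Exports.
Local Open Scope classical_set_scope.
Local Open Scope order_scope.

(* [ord] is a well-ordered type having a greatest element and long enough to
   contain omega_1: a well-ordering of the uncountable type [set nat] with one
   point put on top.  Being well-ordered, it is isomorphic to an initial segment
   of the ordinals, so its elements below [omega1] (the least element having
   uncountably many predecessors) are exactly the countable ordinals. *)
Definition ord : Type := option (set nat).

HB.instance Definition _ := Choice.copy ord (option (set nat)).

Definition wo_rel : rel (set nat) :=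
  sval (wochoice.well_ordering_principle (set nat)).

Lemma wo_relP : wochoice.well_order wo_rel.
Proof. exact: svalP. Qed.

Definition ord_le : rel ord := fun a b =>
  match a, b with
  | _, None => true
  | None, Some _ => false
  | Some x, Some y => wo_rel x y
  end.

Lemma wo_rel_chain : wochoice.wo_chain wo_rel predT.
Proof. by move=> A _; exact: wo_relP. Qed.

Lemma wo_rel_total : total wo_rel.
Proof. by move=> x y; exact: (wochoice.wo_chainW wo_rel_chain). Qed.

Lemma wo_rel_anti : antisymmetric wo_rel.
Proof. by move=> x y; exact: (wochoice.wo_chain_antisymmetric wo_rel_chain). Qed.

Lemma wo_rel_trans : transitive wo_rel.
Proof.
move=> y x z xy yz.
have [|m [[mA mlb] _]] := wo_relP (A := [pred t | t \in [:: x; y; z]]).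
  by exists x; rewrite !inE eqxx.
have mx := mlb x; have my := mlb y; have mz := mlb z.
move: mA mx my mz; rewrite !inE !eqxx ?orbT => /or3P[]/eqP-> mx my mz.
- exact: mz.
- by rewrite (@wo_rel_anti x y) // xy mx.
- by rewrite -(@wo_rel_anti y z) // yz my.
Qed.

Lemma ord_le_refl : reflexive ord_le.
Proof. by case=> //= x; rewrite -[wo_rel x x]orbb wo_rel_total. Qed.

Lemma ord_le_anti : antisymmetric ord_le.
Proof. by case=> [x|] [y|] //= /wo_rel_anti ->. Qed.

Lemma ord_le_trans : transitive ord_le.
Proof. by case=> [x|] [y|] [z|] //=; exact: wo_rel_trans. Qed.

Lemma ord_le_total : total ord_le.
Proof. by case=> [x|] [y|] //=; exact: wo_rel_total. Qed.

Lemma ord_le_wf (S : set ord) : S !=set0 ->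
  exists2 m, S m & forall x, S x -> ord_le m x.
Proof.
move=> [s Ss].
have [[x Sx]|noS] := pselect (exists x, S (Some x)); last first.
  exists s => // t St; case: t St => [t St|_]; first by case: noS; exists t.
  by case: (s).
have [|m [[mS mlb] _]] := wo_relP (A := [pred x | `[< S (Some x) >]]).
  by exists x; apply/asboolP.
exists (Some m); first by apply/asboolP.
by case=> [y Sy|//]; apply: mlb; apply/asboolP.
Qed.

HB.instance Definition _ := Order.Le_isPOrder.Build (Order.Disp tt tt) ord
  ord_le_refl ord_le_anti ord_le_trans.
HB.instance Definition _ :=
  Order.POrder_isTotal.Build (Order.Disp tt tt) ord ord_le_total.

Lemma ord_le_top (a : ord) : a <= (None : ord).
Proof. by case: a. Qed.

HB.instance Definition _ := Order.hasTop.Build (Order.Disp tt tt) ord ord_le_top.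

(* With the convention [least set0 = \top]. *)
Definition least (S : set ord) : ord := xget \top (S `&` lbound S).

Lemma leastP (S : set ord) : S !=set0 -> S (least S) /\ lbound S (least S).
Proof.
move=> /ord_le_wf[m Sm mlb].
by apply: (@xgetPex _ _ (S `&` lbound S)); exists m.
Qed.

Lemma ord_ge_bot (a : ord) : least setT <= a.
Proof. by have [|_] := @leastP setT; [exists a|apply]. Qed.

HB.instance Definition _ :=
  Order.hasBottom.Build (Order.Disp tt tt) ord ord_ge_bot.

Definition omega1 : ord := least [set b | ~ countable [set a | a < b]].

Lemma set_nat_uncountable : ~ countable [set: set nat].
Proof.
move=> /countable_injP[f finj].
pose D : set nat := [set n | exists2 S, f S = n & ~ S n].
have nDf : ~ D (f D).
  move=> /[dup] Df [S fS]; apply; suff -> : S = D by [].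
  by apply: finj; rewrite ?inE.
by apply: (nDf); exists D.
Qed.

Lemma omega1_uncountable : ~ countable [set a : ord | a < omega1].
Proof.
have [|//] := @leastP [set b : ord | ~ countable [set a | a < b]].
exists \top => /= /countable_injP[f finj]; apply: set_nat_uncountable.
apply/countable_injP; exists (fun S => f (Some S)) => S T _ _ /finj.
by rewrite !inE => /(_ isT isT) [].
Qed.

Lemma lt_omega1_countable (b : ord) :
  b < omega1 -> countable [set a : ord | a < b].
Proof.
rewrite ltNge => /negP bN; apply: contrapT => bU; apply: bN.
by have [|_] := @leastP [set b : ord | ~ countable [set a | a < b]];
  [exists b|apply].
Qed.

Definition osucc (a : ord) : ord := least [set b | a < b].

Definition is_limit (c : ord) : Prop :=
  \bot < c /\ ~ (exists2 a, a < c & c = osucc a).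

(* [resolution A B beta G] : the family (G_a)_{a <= beta} belongs to R(A, B).
   [G] is total; its values above [beta] play no role. *)
Definition resolution (X : topologicalType) (A B : set X) (beta : ord)
    (G : ord -> set X) : Prop :=
  [/\ beta < omega1,
      forall a, a <= beta -> open (G a) &
      forall a b, a <= b -> b <= beta -> G a `<=` G b] /\
  [/\ forall a, a < beta ->
        (G (osucc a) `\` G a) `&` A = set0 \/
        (G (osucc a) `\` G a) `&` B = set0,
      forall c, is_limit c -> c <= beta -> G c = \bigcup_(a in [set a | a < c]) G a,
      G \bot = set0 &
      G beta = setT].

Definition sep_rank (X : topologicalType) (A B : set X) : ord :=
  least [set beta | exists G, resolution A B beta G].

Definition fun_sep_rank (R : realType) (X : topologicalType) (f : X -> R)
    (a b : R) : ord :=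
  sep_rank [set x | (f x <= a)%R] [set x | (b <= f x)%R].

Definition osup (S : set ord) : ord := supremum \bot S.

Lemma osupP (S : set ord) : ubound S (osup S) /\ lbound (ubound S) (osup S).
Proof.
rewrite /osup /supremum; case: ifPn => [/eqP ->|_].
  by split=> // a _; exact: le0x.
apply: (@xgetPex _ _ (supremums S)).
have [|ub lb] := @leastP (ubound S); last by exists (least (ubound S)).
by exists \top => a _; exact: lex1.
Qed.

Definition fun_rank (R : realType) (X : topologicalType) (f : X -> R) : ord :=
  osup [set fun_sep_rank f (ratr q.1) (ratr q.2) |
        q in [set q : rat * rat | (q.1 < q.2)%R]].

Definition baire_one (X Y : topologicalType) (f : X -> Y) : Prop :=
  forall U : set Y, open U -> Fsigma (f @^-1` U).

Definition complete_compatible_metric (R : realType) (T : topologicalType)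
    (d : T -> T -> R) : Prop :=
  [/\ forall x y, d x y = 0%R <-> x = y,
      forall x y, d x y = d y x,
      forall x y z, (d x z <= d x y + d y z)%R,
      forall x (U : set T), nbhs x U <->
        exists2 e : R, (0 < e)%R & [set y | (d x y < e)%R] `<=` U &
      forall u : nat -> T,
        (forall e : R, (0 < e)%R ->
           \forall m & n \near \oo, (d (u m) (u n) < e)%R) ->
        exists l : T, u @ \oo --> l].

(* The metric takes its values in the ambient model [R] of the reals. *)
Definition polish (R : realType) (T : topologicalType) : Prop :=
  (exists D : set T, countable D /\ dense D) /\
  (exists d : T -> T -> R, complete_compatible_metric d).

(* Main.v *)
Require Import Defs.
From HB Require Import structures.
From mathcomp Require Import all_boot all_order all_algebra.
From mathcomp Require Import all_classical all_reals all_analysis.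
From mathcomp Require Import lra.
Set Implicit Arguments.
Unset Strict Implicit.
Unset Printing Implicit Defensive.
Import Order.TTheory GRing.Theory Num.Theory.
Import numFieldNormedType.Exports.
Local Open Scope classical_set_scope.
Local Open Scope order_scope.

(* For fixed [a < b] and each [f], the greedy family [alt] is a resolution of
   length [beta] as soon as [alt beta = X]. Suppose that no countable [beta]
   works for all [f] at once. A point outside [alt (osucc c)] is, according to
   the parity of [c], a limit of points outside [alt c] where [f <= a] or where
   [b <= f]. Hence any finite scheme of points lying outside [alt beta] for
   unboundedly many countable [beta] can be extended, and since a countable
   union of bounded subsets of [omega1] is bounded, one can moreover prescribe
   one more digit of countable codes for [f] and for the points of the scheme.
   As [f -> f x] is continuous and each [f] is Baire one, these codes can be
   chosen so that digitwise convergence forces convergence of [f], of the points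
   and of the values of [f] at them. In the limit one gets an [f] in [A] and a
   countable set in which [{f <= a}] and [{f >= b}] are both dense. These are
   disjoint G_delta sets, contradicting the Baire category theorem. *)

(** * Countable ordinals and the greedy resolution *)

Lemma ord_lt_wf : well_founded (fun a b : ord => a < b).
Proof.
move=> c; apply: contrapT => cN.
have [|m /= mN mlb] := @ord_le_wf [set a | ~ Acc (fun a b : ord => a < b) a].
  by exists c.
apply: mN; constructor => a am; apply: contrapT => /mlb.
by change (~ (m <= a)%O); rewrite leNgt am.
Qed.

Lemma osucc_le (a b : ord) : a < b -> osucc a <= b.
Proof.
move=> ab; have [|_ ->//] := @leastP [set c | a < c].
by exists b.
Qed.

Lemma lt_osucc (a b : ord) : a < b -> a < osucc a.
Proof. by move=> ab; have [|//] := @leastP [set c | a < c]; exists b. Qed.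

Lemma lt_osucc_le (a b : ord) : b < osucc a -> b <= a.
Proof. by apply: contraTT; rewrite -!ltNge -leNgt; exact: osucc_le. Qed.

Lemma countable_le_lt_omega1 (a : ord) :
  a < omega1 -> countable [set b : ord | b <= a].
Proof.
move=> aw; have -> : [set b | b <= a] = [set a] `|` [set b | b < a].
  apply/seteqP; split=> b /=; rewrite le_eqVlt.
    by case/orP=> [/eqP|]; [left|right].
  by case=> [->|->]; rewrite ?eqxx ?orbT.
have -> : [set a] `|` [set b | b < a] =
    \bigcup_(i in [set: bool]) (if i then [set a] else [set b | b < a]).
  apply/seteqP; split=> b; first by case; [exists true|exists false].
  by case=> -[] _; [left|right].
apply: bigcup_countable => // -[] _; first exact: countable1.
exact: lt_omega1_countable.
Qed.

(** Otherwise every countable ordinal would lie below some [g i], making the predecessors of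
    [omega1] a countable union of countable sets. *)
Lemma omega1_bounded (I : countType) (g : I -> ord) :
  (forall i, g i < omega1) -> exists2 b, b < omega1 & forall i, g i <= b.
Proof.
move=> gw; apply: contrapT => Nb; apply: omega1_uncountable.
apply: (@sub_countable _ _ _ (\bigcup_(i in [set: I]) [set b | b <= g i])).
  apply: subset_card_le => b /= bw; apply: contrapT => bN; apply: Nb.
  exists b => // i; rewrite leNgt; apply/negP => /ltW big.
  by apply: bN; exists i.
by apply: bigcup_countable => // i _; exact: countable_le_lt_omega1.
Qed.

Lemma omega1_osucc (a : ord) : a < omega1 -> osucc a < omega1.
Proof.
move=> aw; rewrite ltNge; apply/negP => wa; apply: omega1_uncountable.
apply: sub_countable (countable_le_lt_omega1 aw); apply: subset_card_le => b /=.
by move=> /lt_le_trans/(_ wa)/lt_osucc_le.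
Qed.

Lemma omega1_gt0 : (\bot : ord) < omega1.
Proof.
rewrite ltNge lex0; apply/negP => /eqP w0; apply: omega1_uncountable.
suff -> : [set a : ord | a < omega1] = set0 by exact: countable0.
by rewrite w0; apply/seteqP; split=> // a /=; rewrite ltx0.
Qed.

(** For countable [c], this says that [c] is zero or a limit plus an odd integer; zero and the
    limits count as even. *)
Definition parity : ord -> Prop :=
  Fix ord_lt_wf (fun=> Prop) (fun c parity_lt =>
    exists (a : ord) (ac : a < c), c = osucc a /\ ~ parity_lt a ac).

Lemma parityE (c : ord) :
  parity c = exists (a : ord) (_ : a < c), c = osucc a /\ ~ parity a.
Proof.
rewrite /parity Fix_eq// => x f g fg; suff -> : f = g by [].
by apply: functional_extensionality_dep => a;
  apply: functional_extensionality_dep => ax; exact: fg.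
Qed.

Lemma parity_osucc (a : ord) : a < omega1 -> (parity (osucc a) <-> ~ parity a).
Proof.
move=> aw; have aS := lt_osucc aw; rewrite parityE; split; last first.
  by move=> Na; exists a, aS.
move=> [b [bS [ab Nb]]]; suff -> : a = b by [].
apply/le_anti; rewrite (lt_osucc_le bS) andbT.
by apply: lt_osucc_le; rewrite -ab.
Qed.

Lemma parity_cofinal (s : bool) (a : ord) : a < omega1 ->
  exists c, [/\ a <= c, c < omega1 & parity c <-> s].
Proof.
move=> aw; have [p|p] := pselect (parity a <-> s); first by exists a.
exists (osucc a); split; first exact/ltW/(lt_osucc aw).
  exact: omega1_osucc.
rewrite parity_osucc//; split=> [Np|? ?]; last by apply: p; split.
by apply: contrapT => Ns; apply: p; split.
Qed.

Section alternating_resolution.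
Variables (X : topologicalType) (A B : set X).

Definition target (a : ord) : set X :=
  [set x | if `[< parity a >] then A x else B x].

(* [alt c] is the union over [a < c] of the largest open set meeting [target a]
   inside [alt a]: the slowest-growing analogue of a resolution in which the set
   avoided at step [a] is imposed by the parity of [a]. *)
Inductive alt : ord -> X -> Prop :=
  Alt a c x (U : set X) : a < c -> open U -> U x ->
    (forall y, U y -> target a y -> alt a y) -> alt c x.

Lemma alt_mono a b : a <= b -> alt a `<=` alt b.
Proof.
move=> ab x ax; case: ax ab => {}a c {}x U ac oU Ux H cb.
exact: (Alt (lt_le_trans ac cb) oU Ux H).
Qed.

Lemma alt_gt0 c x : alt c x -> \bot < c.
Proof. by case=> a {}c _ _ ac _ _ _; exact: le_lt_trans (le0x a) ac. Qed.

Lemma alt_open c : open (alt c).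
Proof.
rewrite openE => x altx; case: altx => {}a {}c {}x U ac oU Ux H.
rewrite /interior; apply: (@filterS _ _ _ U).
  by move=> y Uy; exact: (Alt ac oU Uy H).
exact: open_nbhs_nbhs.
Qed.

(** Otherwise [U] itself, used in [Alt] at index [a], would put [x] into [alt (osucc a)]. *)
Lemma alt_osuccN a x (U : set X) : a < omega1 -> ~ alt (osucc a) x ->
  open U -> U x -> exists y, [/\ U y, target a y & ~ alt a y].
Proof.
move=> aw Nx oU Ux; apply: contrapT => H; apply: Nx.
apply: (Alt (lt_osucc aw) oU Ux) => y Uy Ay; apply: contrapT => Ny.
by apply: H; exists y.
Qed.

Lemma alt_target a : ((alt (osucc a) `\` alt a) `&` target a = set0)%classic.
Proof.
apply/seteqP; split=> // x [[ax Nax] tx]; move: ax.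
move: {-2}(osucc a) (erefl (osucc a)) => c ca ax.
case: ax Nax tx ca => b {}c {}x U bc oU Ux H Nax tx ca.
(* The index [b] through which [x] entered is at most [a]. If [b = a], then [H] applies to [x],
   which lies in the target; if [b < a], the same [U] puts [x] in [alt a]. *)
move: (bc); rewrite ca => /lt_osucc_le; rewrite le_eqVlt => /orP[/eqP ba|ba].
  by apply: Nax; rewrite -ba; apply: H => //; rewrite ba.
by apply: Nax; exact: (Alt ba oU Ux H).
Qed.

Lemma alt_resolution b : b < omega1 -> alt b = setT -> resolution A B b alt.
Proof.
move=> bw bT; split; split=> //.
- by move=> a _; exact: alt_open.
- by move=> a c ac _; exact: alt_mono.
- move=> a _; have := alt_target a; rewrite /target.
  by case: asboolP => _; [left|right].
- move=> c [_ Nc] _; apply/seteqP; split=> [x cx|x [a /= ac]]; last first.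
    exact: alt_mono (ltW ac) x.
  case: cx Nc => a {}c {}x U ac oU Ux H Nc.
  exists (osucc a); last exact: (Alt (lt_osucc ac) oU Ux H).
  rewrite /= lt_neqAle osucc_le// andbT; apply/eqP => ca.
  by apply: Nc; exists a.
- by apply/seteqP; split=> // x /alt_gt0; rewrite ltxx.
Qed.

Lemma sep_rank_le b : b < omega1 -> alt b = setT -> sep_rank A B <= b.
Proof.
move=> bw bT; have bR : exists G, resolution A B b G.
  by exists alt; exact: alt_resolution.
have [|_ ->//] := @leastP [set b | exists G, resolution A B b G].
by exists b.
Qed.

End alternating_resolution.

(** * Complete compatible metrics *)

Lemma natSinv_lt (R : realType) (e : R) : (0 < e)%R ->
  exists n : nat, (n.+1%:R^-1 < e)%R.
Proof. by move=> /ltr_add_invr[n]; rewrite add0r; exists n. Qed.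

Section metric_topology.
Local Open Scope ring_scope.
Variables (R : realType) (T : topologicalType) (d : T -> T -> R).
Hypothesis dP : complete_compatible_metric d.

Lemma ccm_refl x : d x x = 0.
Proof. by have [dxx _ _ _ _] := dP; apply/dxx. Qed.

Lemma ccm_sym x y : d x y = d y x.
Proof. by have [_] := dP. Qed.

Lemma ccm_triangle y x z : d x z <= d x y + d y z.
Proof. by have [_ _] := dP. Qed.

Lemma ccm_nbhs x e : 0 < e -> nbhs x [set y | d x y < e].
Proof. by have [_ _ _ H _] := dP => e0; apply/H; exists e. Qed.

Lemma ccm_nbhsP x (U : set T) : nbhs x U ->
  exists2 e, 0 < e & [set y | d x y < e] `<=` U.
Proof. by have [_ _ _ H _] := dP => /H. Qed.

Lemma ccm_open x e : open [set y | d x y < e].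
Proof.
rewrite openE => y /= xye; rewrite /interior.
have /(ccm_nbhs y) : 0 < e - d x y by rewrite subr_gt0.
apply: filterS => z /= yz; have := ccm_triangle y x z; lra.
Qed.

Lemma ccm_cvg (u : nat -> T) l e : u @ \oo --> l -> 0 < e ->
  \forall n \near \oo, d l (u n) < e.
Proof. by move=> ul e0; exact: ul _ (ccm_nbhs l e0). Qed.

(** The centre may change with [e], so that the term of a dense sequence named by a digit can serve
    as centre. *)
Lemma ccm_complete (u : nat -> T) :
  (forall e, 0 < e -> exists c, \forall n \near \oo, d c (u n) < e) ->
  exists l : T, u @ \oo --> l.
Proof.
move=> H; have [_ _ _ _ cauchy_cvg] := dP; apply: cauchy_cvg => e e0.
have [|c cu] := H (e / 2); first by rewrite divr_gt0.
near=> m n; have := ccm_triangle c (u m) (u n); rewrite (ccm_sym (u m) c).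
have : d c (u m) < e / 2 by near: m.
have : d c (u n) < e / 2 by near: n.
lra.
Unshelve. all: by end_near. Qed.

(** The nested balls are centred in [D], which need not be closed: their limit may leave [D] but
    stays in every [O n]. *)
Lemma ccm_baire (D : set T) (O : nat -> set T) : D !=set0 ->
  (forall n, open (O n)) ->
  (forall n x U, D x -> nbhs x U -> exists y, [/\ D y, U y & O n y]) ->
  exists x, forall n, O n x.
Proof.
move=> [x0 Dx0] oO DO.
pose good (p : T * R) := D p.1 /\ 0 < p.2.
(* The doubled radius leaves room for the limit of the centres, which is only known to lie in the
   closure of the new ball. *)
have step (np : nat * (T * R)) : exists q, good np.2 ->
    [/\ good q, q.2 <= np.1.+1%:R^-1 & forall z, d q.1 z < q.2 *+ 2 ->
     d np.2.1 z < np.2.2 /\ O np.1 z].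
  case: np => n [x e] /=.
  have [[/= Dx e0]|] := pselect (good (x, e)); last by exists (x, e).
  have [y [Dy xy Oy]] := DO n x _ Dx (ccm_nbhs x e0).
  have : nbhs y ([set z | d x z < e] `&` O n).
    apply: open_nbhs_nbhs; split => //.
    by apply: openI; [exact: ccm_open|exact: oO].
  case/ccm_nbhsP => r r0 yr.
  exists (y, Num.min (r / 2) n.+1%:R^-1) => _; split.
  - by split=> //=; rewrite lt_min divr_gt0//= invr_gt0.
  - by rewrite /= ge_min lexx orbT.
  - move=> z /= yz; apply: yr => /=; apply: lt_le_trans yz _.
    rewrite mulr2n; have : Num.min (r / 2) n.+1%:R^-1 <= r / 2.
      by rewrite ge_min lexx.
    by move: (Num.min _ _) => t; lra.
have [next nextP] := choice step.
pose s := fix s n := if n is m.+1 then next (m, s m) else (x0, 1 : R).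
have gs n : good (s n).
  elim: n => [|n IH]; first by split => //=.
  by have [] := nextP (n, s n) IH.
have s_le n : (s n.+1).2 <= n.+1%:R^-1 by have [] := nextP (n, s n) (gs n).
have sP n z : d (s n.+1).1 z < (s n.+1).2 *+ 2 ->
    d (s n).1 z < (s n).2 /\ O n z.
  by have [_ _] := nextP (n, s n) (gs n); apply.
have s_nest n m z : d (s (m + n)%N).1 z < (s (m + n)%N).2 ->
    d (s n).1 z < (s n).2.
  elim: m => [//|m IH] H; apply: IH; apply: (sP (m + n)%N z _).1.
  by apply: lt_le_trans H _; rewrite mulr2n lerDl ltW ?(gs _).2.
have s_in n m : (n <= m)%N -> d (s n).1 (s m).1 < (s n).2.
  move=> nm; apply: (s_nest n (m - n)%N); rewrite subnK//.
  by rewrite ccm_refl; exact: (gs m).2.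
have [|l sl] := @ccm_complete (fun n => (s n).1).
  move=> e /natSinv_lt[n ne]; exists (s n.+1).1; exists n.+1 => // m /= nm.
  apply: lt_trans ne; apply: lt_le_trans (s_in _ _ nm) _; exact: s_le.
exists l => n; apply: (sP n l _).2; set e := (s n.+1).2.
have e0 : 0 < e by exact: (gs _).2.
have [m] := filter_ex (filterI (ccm_cvg sl e0) (nbhs_infty_ge n.+1)).
move=> [/= lm nm]; have := ccm_triangle (s m).1 (s n.+1).1 l.
have := s_in _ _ nm; rewrite -/e (ccm_sym (s m).1) mulr2n; lra.
Qed.

End metric_topology.

(** The sets [f <= a] and [b <= f] are the complements of the unions of the closed sets [F n] and
    [G n]. If both cluster at every point of [D], [ccm_baire] yields a point common to the two. *)
Lemma baire_one_no_oscillation (R : realType) (X : topologicalType)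
    (d : X -> X -> R) (f : X -> R) (a b : R) (D : set X) :
  complete_compatible_metric d -> baire_one f -> (a < b)%R -> D !=set0 ->
  (forall x U, D x -> nbhs x U ->
    (exists y, [/\ D y, U y & (f y <= a)%R]) /\
    (exists y, [/\ D y, U y & (b <= f y)%R])) -> False.
Proof.
move=> dP fb ab D0 Dosc.
have [F cF FE] := fb [set y | (a < y)%R] (@open_gt _ a).
have [G cG GE] := fb [set y | (y < b)%R] (@open_lt _ b).
have notF y n : (f y <= a)%R -> ~ F n y.
  move=> ya Fy; have : (f @^-1` [set y | (a < y)%R]) y by rewrite FE; exists n.
  by rewrite /= ltNge ya.
have notG y n : (b <= f y)%R -> ~ G n y.
  move=> ya Fy; have : (f @^-1` [set y | (y < b)%R]) y by rewrite GE; exists n.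
  by rewrite /= ltNge ya.
have [|||x Ox] := @ccm_baire _ _ _ dP D (fun n => ~` F n `&` ~` G n) => //.
- by move=> n; apply: openI; apply: closed_openC.
(* Two moves: first to [y] outside [F n], then, within a neighbourhood of [y] avoiding [F n], to a
   point outside [G n]. *)
- move=> n x U Dx xU; have [y [Dy Uy ya]] := (Dosc _ _ Dx (nbhs_interior xU)).1.
  have yUF : nbhs y (U `&` ~` F n).
    apply: filterI; first exact: Uy.
    by apply: open_nbhs_nbhs; split; [exact: closed_openC|exact: notF].
  have [z [Dz [Uz Fz] zb]] := (Dosc _ _ Dy yUF).2.
  by exists z; split=> //; split=> //; exact: notG.
have xa : (f x <= a)%R.
  rewrite leNgt; apply/negP => ax.
  have : (f @^-1` [set y | (a < y)%R]) x by [].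
  by rewrite FE => -[n _]; exact: (Ox n).1.
have : (f @^-1` [set y | (y < b)%R]) x by exact: le_lt_trans xa ab.
by rewrite GE => -[n _]; exact: (Ox n).2.
Qed.

(** * Coherent schemes *)

Section coherent_configurations.
Variables (R : realType) (T : Type) (X : topologicalType) (d : X -> X -> R).
Hypothesis dP : complete_compatible_metric d.
Variables (phi : T -> X -> R) (a b : R) (C : countType).
Variable code : T -> X -> nat -> C.

Local Notation low f := [set x | (phi f x <= a)%R].
Local Notation high f := [set x | (b <= phi f x)%R].
Local Notation rest f beta x := (~ alt (low f) (high f) beta x).

(* [y] is the [j]-th point of a scheme and [x] the [logn 3 j]-th one: as [j]
   ranges over the numbers of given parity with [logn 3 j = i], points of the
   corresponding side cluster at the [i]-th point. *)
Definition attached (f : T) (j : nat) (x y : X) : Prop :=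
  (d x y < j.+1%:R^-1)%R /\ (if odd j then low f y else high f y).

(** A scheme pairs an element of [T] with a list of points. Largeness is the invariant of the
    construction: it survives a partition into countably many pieces and the addition of an attached
    point. *)
Definition large (x0 : X) (n : nat) (K : set (T * seq X)) : Prop :=
  forall beta, beta < omega1 -> exists c, [/\ K c, size c.2 = n &
    forall i, (i < n)%N -> rest c.1 beta (nth x0 c.2 i)].

Definition code_upto (n : nat) (c : T * seq X) : seq (seq C) :=
  [seq [seq code c.1 x k | k <- iota 0 n] | x <- c.2].

(** If each class [h c = v] failed at some countable ordinal, a common countable bound of these
    ordinals would make [K] fail too, since [alt] is increasing. *)
Lemma large_refine (V : countType) (h : T * seq X -> V) x0 n K :
  large x0 n K -> exists v, large x0 n (K `&` [set c | h c = v]).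
Proof.
move=> Kn; apply: contrapT => H.
have bad v : exists beta, beta < omega1 /\ forall c, K c -> size c.2 = n ->
    h c = v -> ~ forall i, (i < n)%N -> rest c.1 beta (nth x0 c.2 i).
  apply: contrapT => Hv; apply: H; exists v => beta bw; apply: contrapT => Hc.
  apply: Hv; exists beta; split=> // c Kc sc hc Hi; apply: Hc; exists c.
  by split.
have [g gP] := choice bad.
have [beta bw gb] := omega1_bounded (fun v => (gP v).1).
have [c [Kc sc Hc]] := Kn beta bw.
have [_ /(_ c Kc sc erefl)] := gP (h c); apply => i iN ci.
exact: (Hc i iN (alt_mono (gb _) ci)).
Qed.

Lemma large_extend x0 n K : large x0 n.+1 K ->
  large x0 n.+2 [set c | exists s y, [/\ c.2 = rcons s y, K (c.1, s),
    size s = n.+1 & attached c.1 n.+1 (nth x0 s (logn 3 n.+1)) y]].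
Proof.
move=> Kn beta bw.
(* The parity of [g] makes [target g] the side required at index [n.+1]. Taking the old points
   outside [alt (osucc g)] makes each of them a limit of points of that side outside [alt g]. *)
have [g [bg gw gp]] := parity_cofinal (odd n.+1) bw.
have [[f s] /= [Kc sc Hc]] := Kn (osucc g) (omega1_osucc gw).
have ln : (logn 3 n.+1 < n.+1)%N by exact: ltn_logl.
have [|y [Uy ty Ny]] := alt_osuccN gw (Hc _ ln)
    (ccm_open dP (nth x0 s (logn 3 n.+1)) n.+2%:R^-1%R).
  by rewrite /= ccm_refl// invr_gt0.
exists (f, rcons s y); split=> /=; last 2 first.
- by rewrite size_rcons sc.
- move=> i iN; rewrite nth_rcons sc; case: ltnP => [lin|nli].
    move=> /(alt_mono bg) ai; apply: (Hc i lin); apply: alt_mono ai.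
    exact/ltW/(lt_osucc gw).
  have -> : i = n.+1 by apply/eqP; rewrite eqn_leq nli andbT.
  by rewrite eqxx => /(alt_mono bg).
exists s, y; split=> //; split=> //; move: ty; rewrite /target.
by case: asboolP => /gp; case: odd.
Qed.

Lemma coherent_configurations :
  (forall beta, beta < omega1 -> exists f x, rest f beta x) ->
  exists (F : nat -> T) (z : nat -> nat -> X),
    (forall n j, (0 < j <= n)%N -> attached (F n) j (z n (logn 3 j)) (z n j)) /\
    (forall i k, exists v, \forall n \near \oo, code (F n) (z n i) k = v).
Proof.
move=> H; have [f0 [x0 _]] := H _ omega1_gt0.
pose link n (K K' : set (T * seq X)) := large x0 n.+2 K' /\
  (exists v, forall c, K' c -> [/\ code_upto n.+2 c = v & exists s y,
    [/\ c.2 = rcons s y, K (c.1, s), size s = n.+1 &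
        attached c.1 n.+1 (nth x0 s (logn 3 n.+1)) y]]).
have step (nK : nat * set (T * seq X)) :
    exists K', large x0 nK.1.+1 nK.2 -> link nK.1 nK.2 K'.
  case: nK => n K /=; have [Kn|] := pselect (large x0 n.+1 K); last by exists K.
  have [v vP] := large_refine (code_upto n.+2) (large_extend Kn).
  by eexists => _; split; [exact: vP|exists v => c []].
have [next nextP] := choice step.
pose K := fix K n := if n is m.+1 then next (m, K m) else
  [set c : T * seq X | size c.2 = 1%N].
have KL n : large x0 n.+1 (K n).
  elim: n => [|n IH]; last by have [] := nextP (n, K n) IH.
  move=> beta /H[f [x fx]]; exists (f, [:: x]); split=> //= i.
  by rewrite ltnS leqn0 => /eqP ->.
have KP n : link n (K n) (K n.+1) by exact: nextP (n, K n) (KL n).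
have Ksize n c : K n c -> size c.2 = n.+1.
  case: n c => [c //|n] c.
  have [_ [v vP]] := KP n => /vP[_ [s [y [-> _ sn _]]]].
  by rewrite size_rcons sn.
have Ktake n m c : (n <= m)%N -> K m c -> K n (c.1, take n.+1 c.2).
  elim: m c => [|m IH] [f s].
    rewrite leqn0 => /eqP -> Kc; have := Ksize _ _ Kc => /= <-.
    by rewrite take_size.
  rewrite leq_eqVlt => /orP[/eqP -> Kc|nm].
    by have := Ksize _ _ Kc => /= <-; rewrite take_size.
  have [_ [v vP]] := KP m => /vP[_ [t [y /= [-> Kt tm _]]]].
  have := IH _ nm Kt; rewrite /= -cats1 takel_cat// tm.
  by rewrite ltnS.
have Katt n c j : K n c -> (0 < j <= n)%N ->
    attached c.1 j (nth x0 c.2 (logn 3 j)) (nth x0 c.2 j).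
  elim: n c j => [|n IH] [f s] j; first by case: j.
  have [_ [v vP]] := KP n => /vP[_ [t [y /= [-> Kt tn att]]]] /andP[j0 jn].
  have lj : (logn 3 j < j)%N by exact: ltn_logl.
  rewrite !nth_rcons tn (leq_trans lj jn).
  move: jn; rewrite leq_eqVlt => /orP[/eqP ->|jn].
    by rewrite ltnn eqxx.
  by rewrite jn; apply: IH Kt _; rewrite j0.
have Kne n : exists c, K n c.
  by have [c []] := KL n _ omega1_gt0; exists c.
have [c cP] := choice Kne.
exists (fun n => (c n).1), (fun n => nth x0 (c n).2); split.
  by move=> n j; exact: Katt.
(* From this stage on every scheme has a point of index [i], and digit [k] of that point is
   frozen. *)
move=> i k; pose n := (maxn i k).+1.
have [_ [v vP]] := KP (maxn i k).
have il : (i < n.+1)%N by rewrite ltnS leqW// leq_maxl.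
have kl : (k < n.+1)%N by rewrite ltnS leqW// leq_maxr.
exists (nth (code f0 x0 0%N) (nth [::] v i) k); exists n => // m /= nm.
have Km := Ktake _ _ _ nm (cP m); have [<- _] := vP _ Km.
rewrite /code_upto (nth_map x0) ?(Ksize _ _ Km)//.
by rewrite (nth_map 0%N) ?size_iota// nth_iota// nth_take.
Qed.

End coherent_configurations.

(** * Coding the evaluation map *)

Lemma countable_dense_seq (T : topologicalType) (D : set T) (t0 : T) :
  countable D -> dense D ->
  exists e : nat -> T, forall (x : T) U, nbhs x U -> exists n, U (e n).
Proof.
move=> /countable_injP[g ginj] Dd.
exists (fun n => xget t0 [set t | D t /\ g t = n]) => x U xU.
have [t [Ut Dt]] : U^° `&` D !=set0.
  by apply: Dd; [exists x|exact: open_interior].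
exists (g t); case: xgetP => [s _ [Ds gs]|/(_ t)[]//].
by rewrite (ginj s t) ?inE//; exact: interior_subset.
Qed.

(** Digit [m] of [t] is the index of a term of [e] within [m.+1%:R^-1] of [t], so stable digits
    force the Cauchy condition. *)
Lemma metric_code (R : realType) (T : topologicalType) (d : T -> T -> R)
    (e : nat -> T) :
  complete_compatible_metric d ->
  (forall (t : T) U, nbhs t U -> exists n, U (e n)) ->
  exists c : T -> nat -> nat, forall u : nat -> T,
    (forall m, exists v, \forall n \near \oo, c (u n) m = v) ->
    exists l : T, u @ \oo --> l.
Proof.
move=> dP eP.
have near_e (tm : T * nat) : exists n, (d tm.1 (e n) < tm.2.+1%:R^-1)%R.
  by apply: (eP tm.1 [set y | (d tm.1 y < tm.2.+1%:R^-1)%R]);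
    apply: ccm_nbhs => //; rewrite invr_gt0.
have [c cP] := choice near_e.
exists (fun t m => c (t, m)) => u cu; apply: (ccm_complete dP) => r.
move=> /natSinv_lt[m mr]; have [v vP] := cu m; exists (e v).
near=> n; apply: lt_trans mr; rewrite ccm_sym//.
have <- : c (u n, m) = v by near: n.
exact: cP (u n, m).
Unshelve. all: by end_near. Qed.

Lemma open_dist_lt (R : realType) (c e : R) :
  open [set y : R | (`|y - c| < e)%R].
Proof.
have -> : [set y : R | (`|y - c| < e)%R] =
    [set y | (c - e < y)%R] `&` [set y | (y < c + e)%R].
  by apply/seteqP; split=> y /=; rewrite ltr_distl => /andP.
by apply: openI; [exact: open_gt|exact: open_lt].
Qed.

Section coding.
Local Open Scope ring_scope.
Variables (R : realType) (T X : topologicalType).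
Variables (dT : T -> T -> R) (dX : X -> X -> R) (eT : nat -> T) (eX : nat -> X).
Hypotheses (dTP : complete_compatible_metric dT)
  (dXP : complete_compatible_metric dX).
Hypotheses (eTP : forall (t : T) U, nbhs t U -> exists n, U (eT n))
  (eXP : forall (x : X) U, nbhs x U -> exists n, U (eX n)).
Variable phi : T -> X -> R.
Hypotheses (phi_cont : forall x, continuous (phi^~ x))
  (phi_baire : forall t, baire_one (phi t)).


(* At precision [m.+1%:R^-1], the digit [q] approximates [phi f x], and [r] is
   such that [phi g x] stays near [q] for [g] within [r.+1%:R^-1] of [f]. For
   [eT j] in that ball, [l] selects a closed piece of the F_sigma set of points
   where [phi (eT j)] is near [q], a condition on [x] that passes to limits. *)
Lemma evaluation_code : exists (C : countType) (code : T -> X -> nat -> C),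
  forall (F : nat -> T) (z : nat -> X),
    (forall k, exists v, \forall n \near \oo, code (F n) (z n) k = v) ->
    (exists f : T, F @ \oo --> f) /\
    forall f : T, F @ \oo --> f -> exists2 x : X, z @ \oo --> x &
      (fun n => phi (F n) (z n)) @ \oo --> phi f x.
Proof.
have [cT cTP] := metric_code dTP eTP; have [cX cXP] := metric_code dXP eXP.
have q_ex (fxm : T * X * nat) : exists p : rat,
    `|phi fxm.1.1 fxm.1.2 - ratr p| < fxm.2.+1%:R^-1.
  case: fxm => -[f x] m /=; set r := m.+1%:R^-1.
  have [|p] := @rat_in_itvoo R (phi f x - r) (phi f x + r).
    by rewrite ltrBlDr -addrA ltrDl addr_gt0 ?invr_gt0.
  by rewrite in_itv/= => /andP[? ?]; exists p; rewrite ltr_distlC; apply/andP.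
have [q qP] := choice q_ex.
have r_ex (fxm : T * X * nat) : exists n : nat, forall g,
    dT fxm.1.1 g < n.+1%:R^-1 ->
    `|phi g fxm.1.2 - ratr (q fxm)| < fxm.2.+1%:R^-1.
  have /(ccm_nbhsP dTP)[e e0 eP] : nbhs fxm.1.1
      [set g | `|phi g fxm.1.2 - ratr (q fxm)| < fxm.2.+1%:R^-1].
    apply: (@phi_cont fxm.1.2 fxm.1.1
      [set y | `|y - ratr (q fxm)| < fxm.2.+1%:R^-1]); apply: open_nbhs_nbhs.
    by split; [exact: open_dist_lt|exact: qP].
  have [n ne] := natSinv_lt e0; exists n => g gn; apply: eP.
  exact: lt_trans gn ne.
have [r rP] := choice r_ex.
have Z_ex (jmp : nat * nat * rat) : exists Z : nat -> set X,
    (forall l, closed (Z l)) /\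
    forall x, `|phi (eT jmp.1.1) x - ratr jmp.2| < jmp.1.2.+1%:R^-1 <->
      exists l, Z l x.
  case: jmp => -[j m] p /=.
  have [Z cZ ZE] := @phi_baire (eT j) _ (@open_dist_lt R (ratr p) m.+1%:R^-1).
  exists Z; split=> // x.
  have -> : (`|phi (eT j) x - ratr p| < m.+1%:R^-1 : Prop) =
    (phi (eT j) @^-1` [set y | `|y - ratr p| < m.+1%:R^-1]) x by [].
  by rewrite ZE; split=> [[l _ ?]|[l ?]]; exists l.
have [Z ZP] := choice Z_ex.
have l_ex (fxmj : T * X * nat * nat) : exists l : nat,
    let: (fxm, j) := fxmj in dT fxm.1.1 (eT j) < (r fxm).+1%:R^-1 ->
    Z (j, fxm.2, q fxm) l fxm.1.2.
  case: fxmj => -[[f x] m] j /=.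
  have [near_j|] := pselect (dT f (eT j) < (r (f, x, m)).+1%:R^-1);
    last by exists 0%N.
  have /(ZP (j, m, q (f, x, m))).2[k kP] := rP (f, x, m) _ near_j.
  by exists k.
have [l lP] := choice l_ex.
(* A digit index encodes a precision [m] and an index [j] into [eT], with [(0, 0)] for numbers that
   encode no pair. *)
pose dg k : nat * nat := odflt (0, 0)%N (unpickle k).
exists (nat * nat * (rat * nat) * nat)%type,
  (fun f x k => let: (m, j) := dg k in
  (cT f m, cX x m, (q (f, x, m), r (f, x, m)), l (f, x, m, j))) => F z codeP.
have codeE m j : exists v, \forall n \near \oo, (cT (F n) m, cX (z n) m,
    (q (F n, z n, m), r (F n, z n, m)), l (F n, z n, m, j)) = v.
  by have [v] := codeP (pickle (m, j)); rewrite /dg pickleK /=; exists v.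
split=> [|f Ff].
  apply: cTP => m; have [v vP] := codeE m 0%N.
  by exists v.1.1.1; apply: filterS vP => n <-.
have [|x zx] := cXP z.
  move=> m; have [v vP] := codeE m 0%N.
  by exists v.1.1.2; apply: filterS vP => n <-.
exists x => //; apply/cvgrPdist_lt => e e0.
have [|m me] := @natSinv_lt _ (e / 2); first by rewrite divr_gt0.
have [v0 v0P] := codeE m 0%N; set p := v0.1.2.1; set s := v0.1.2.2.
have close_j j : dT f (eT j) < s.+1%:R^-1 ->
    `|phi (eT j) x - ratr p| < m.+1%:R^-1.
  move=> fj; apply/(ZP (j, m, p)).2; have [v vP] := codeE m j.
  exists v.2; apply: (closed_cvg _ ((ZP (j, m, p)).1 v.2) _ x zx).
  have Fj : \forall n \near \oo, dT (F n) (eT j) < s.+1%:R^-1.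
    move: fj; rewrite ccm_sym// => fj.
    have fS := open_nbhs_nbhs (conj (ccm_open dTP (eT j) s.+1%:R^-1) fj).
    by near=> n; rewrite ccm_sym//; near: n; exact: Ff _ fS.
  near=> n.
  have -> : p = q (F n, z n, m).
    by rewrite /p; have <- := near v0P n.
  have <- : l (F n, z n, m, j) = v.2 by have <- := near vP n.
  apply: (lP (F n, z n, m, j)) => /=.
  have -> : r (F n, z n, m) = s by rewrite /s; have <- := near v0P n.
  by near: n.
(* [close_j] only concerns terms of [eT]; continuity of [phi^~ x] at [f] and density carry the
   estimate over to [f], as a non-strict one. *)
have pf : `|phi f x - ratr p| <= m.+1%:R^-1.
  rewrite leNgt; apply/negP => far.
  have : nbhs f ([set g | dT f g < s.+1%:R^-1] `&`
      [set g | `|phi g x - phi f x| < `|phi f x - ratr p| - m.+1%:R^-1]).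
    apply: filterI; first by apply: ccm_nbhs => //; rewrite invr_gt0.
    apply: (@phi_cont x f [set y | `|y - _| < _]); apply: open_nbhs_nbhs.
    split; first exact: open_dist_lt.
    by rewrite /= subrr normr0 subr_gt0.
  case/eTP => j [/close_j]; have := ler_distD (phi (eT j) x) (phi f x) (ratr p).
  by rewrite /= (distrC (phi f x) (phi (eT j) x)); move: m.+1%:R^-1 => t; lra.
near=> n.
have : `|phi (F n) (z n) - ratr p| < m.+1%:R^-1.
  have -> : p = q (F n, z n, m) by rewrite /p; have <- := near v0P n.
  exact: (qP (F n, z n, m)).
move: me pf; move: m.+1%:R^-1 => t.
rewrite !ltr_norml ler_norml => te /andP[? ?] /andP[? ?].
by apply/andP; split; lra.
Unshelve. all: by end_near. Qed.

End coding.

(** * Uniform bound on the separation ranks *)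

(** A power of 5 or of 2 adjusts size and parity without changing the valuation at 3. Hence each
    point of the limit scheme gets attached points of both sides at arbitrarily small distance. *)
Lemma exists_logn3 (i N : nat) (s : bool) :
  exists j, [/\ (0 < j)%N, (N <= j)%N, logn 3 j = i & odd j = s].
Proof.
have log_coprime p : prime p -> 3 != p -> logn 3 (3 ^ i * p ^ N.+1)%N = i.
  move=> pp p3; have p0 := prime_gt0 pp.
  rewrite lognM ?expn_gt0 ?p0// pfactorK// lognX.
  by rewrite logn_prime// (negbTE p3) muln0 addn0.
have large p : prime p -> (N <= 3 ^ i * p ^ N.+1)%N.
  move=> pp; apply: leq_trans (leq_pmull _ (expn_gt0 3 i)).
  exact/ltnW/ltnW/ltn_expl/prime_gt1.
have pos p : prime p -> (0 < 3 ^ i * p ^ N.+1)%N.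
  by move=> /prime_gt0 p0; rewrite muln_gt0 !expn_gt0 p0.
case: s; [exists (3 ^ i * 5 ^ N.+1)%N|exists (3 ^ i * 2 ^ N.+1)%N]; split.
all: rewrite ?pos ?large ?log_coprime// oddM !oddX//.
  by rewrite /= !orbT.
by rewrite /= orbT.
Qed.

Lemma alt_uniform_bound (R : realType) (T X : topologicalType)
    (phi : T -> X -> R) (a b : R) :
  polish R T -> polish R X -> (forall x, continuous (phi^~ x)) ->
  (forall t, baire_one (phi t)) -> (a < b)%R ->
  exists2 beta, beta < omega1 & forall t,
    alt [set x | (phi t x <= a)%R] [set x | (b <= phi t x)%R] beta = setT.
Proof.
move=> [[DT [DTc DTd]] [dT dTP]] [[DX [DXc DXd]] [dX dXP]] phic phib ab.
apply: contrapT => unbounded.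
have rest beta : beta < omega1 -> exists t x,
    ~ alt [set x | (phi t x <= a)%R] [set x | (b <= phi t x)%R] beta x.
  move=> bw; apply: contrapT => H; apply: unbounded; exists beta => // t.
  apply/seteqP; split=> // x _; apply: contrapT => Nx; apply: H.
  by exists t, x.
have [t0 [x0 _]] := rest _ omega1_gt0.
have [eT eTP] := countable_dense_seq t0 DTc DTd.
have [eX eXP] := countable_dense_seq x0 DXc DXd.
have [C [code codeP]] := evaluation_code dTP dXP eTP eXP phic phib.
have [F [z [zP Fz]]] := coherent_configurations dXP code rest.
have [[t Ft] _] := codeP F (z^~ 0%N) (Fz 0%N).
have x_ex i : exists x : X, z^~ i @ \oo --> x /\
    (fun n => phi (F n) (z n i)) @ \oo --> phi t x.
  by have [_ /(_ t Ft)[x zx fx]] := codeP F (z^~ i) (Fz i); exists x.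
have [x xP] := choice x_ex.
(* [attached] fixes the side of [z n j] for all [n >= j], and non-strict inequalities pass to the
   limit. *)
have low j : (0 < j)%N -> odd j -> (phi t (x j) <= a)%R.
  move=> j0 oj; apply: cvgr_to_le (xP j).2 _; exists j => // n /= jn.
  by have [|_] := zP n j; rewrite ?j0// oj.
have high j : (0 < j)%N -> ~~ odd j -> (b <= phi t (x j))%R.
  move=> j0 oj; apply: cvgr_to_ge (xP j).2 _; exists j => // n /= jn.
  by have [|_] := zP n j; rewrite ?j0// (negbTE oj).
have cluster i U s : nbhs (x i) U ->
    exists j, [/\ (0 < j)%N, odd j = s & U (x j)].
  case/(ccm_nbhsP dXP) => e e0 eU.
  (* One third for each leg of the path [x i], [z n i], [z n j], [x j]. *)
  have e3 : (0 < e / 3)%R by rewrite divr_gt0.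
  have [N Ne] := natSinv_lt e3.
  have [j [j0 Nj ji js]] := exists_logn3 i N s.
  exists j; split=> //; apply: eU => /=.
  have [n [[/= zi zj] jn]] := filter_ex (filterI (filterI
    (ccm_cvg dXP (xP i).1 e3) (ccm_cvg dXP (xP j).1 e3)) (nbhs_infty_ge j)).
  have [|zij _] := zP n j; first by rewrite j0.
  rewrite ji in zij.
  have zij3 : (dX (z n i) (z n j) < e / 3)%R.
    apply: (lt_trans zij); apply: le_lt_trans Ne.
    by rewrite lef_pV2 ?posrE// ler_nat.
  have := ccm_triangle dXP (z n i) (x i) (x j).
  have := ccm_triangle dXP (z n j) (z n i) (x j).
  rewrite (ccm_sym dXP (z n j)); lra.
apply: (baire_one_no_oscillation (D := range x) dXP (phib t) ab).
  by exists (x 0%N), 0%N.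
move=> _ U [i _ <-] iU; split.
  have [j [j0 oj Uj]] := cluster i U true iU.
  by exists (x j); split=> //; exact: low.
have [j [j0 oj Uj]] := cluster i U false iU.
by exists (x j); split=> //; apply: high; rewrite ?oj.
Qed.

Theorem proposition17 (R : realType) (X : topologicalType) (Y : set R)
    (A : set {ptws X -> Y}) :
  polish R X ->
  (forall f : {ptws X -> Y}, A f -> baire_one f) ->
  polish R A ->
  osup [set fun_rank (fun x => set_val (f x)) | f in A] < omega1.
Proof.
move=> pX bA pA.
pose phi (f : A) (x : X) : R := set_val ((set_val f : {ptws X -> Y}) x).
have phi_cont x : continuous (phi^~ x).
  have cA : continuous (set_val : A -> {ptws X -> Y}).
    exact: initial_continuous.
  have cx : continuous (fun f : {ptws X -> Y} => f x).
    exact: (@proj_continuous X (fun=> Y) x).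
  have cY : continuous (set_val : Y -> R) by exact: initial_continuous.
  move=> f.
  apply: (@cvg_comp _ _ _ (fun f : A => (set_val f : {ptws X -> Y}) x)
    (set_val : Y -> R) _ _ _ _ (cY _)).
  exact: (@cvg_comp _ _ _ (set_val : A -> {ptws X -> Y})
    (fun f : {ptws X -> Y} => f x) _ _ _ (cA f) (cx _)).
have phi_baire f : baire_one (phi f).
  move=> U oU; have oV : open ((set_val : Y -> R) @^-1` U).
    by apply: open_comp oU => y _; exact: initial_continuous.
  exact: bA _ (set_valP f) _ oV.
(* Each increasing rational pair gets a countable bound valid for all of [A], other pairs get
   [\bot]; as there are countably many pairs, one countable [beta] dominates all these bounds. *)
have bound (q : rat * rat) : exists beta, beta < omega1 /\ ((q.1 < q.2)%R ->
    forall f, alt [set x | (phi f x <= ratr q.1)%R]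
                  [set x | (ratr q.2 <= phi f x)%R] beta = setT).
  have [q12|] := pselect (q.1 < q.2)%R; last first.
    by exists \bot; split=> //; exact: omega1_gt0.
  have [|beta bw betaP] := alt_uniform_bound (a := ratr q.1) (b := ratr q.2)
    pA pX phi_cont phi_baire; first by rewrite ltr_rat.
  by exists beta.
have [beta_ beta_P] := choice bound.
have [beta bw beta_le] := omega1_bounded (fun q => (beta_P q).1).
apply: le_lt_trans bw; apply: (osupP _).2 => _ [f Af <-].
apply: (osupP _).2 => _ [q q12 <-]; apply: le_trans (beta_le q).
have [qw /(_ q12 (exist _ f (mem_set Af)))] := beta_P q.
exact: sep_rank_le.
Qed.
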